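(* Let $m$ be a positive integer, $D$ a square-free positive integer, and $t$ the number of distinct prime factors of $D$. For $Q>1$ let $\mathcal{F}_{m,D}(Q)$ be the set of polynomials $f(x)=\sum_{k=0}^{2m}c_kx^k\in\mathbb{Z}[x]$ with $c_k=c_{2m-k}$ for all $k$ and $c_0=c_{2m}=1$, such that (i) $f$ is irreducible over $\mathbb{Q}$; (ii) $f(1)f(-1)=-Dk^2$ for some $k\in\mathbb{Q}$; (iii) $f$ has distinct roots $\lambda,\lambda^{-1},\mu_1,\mu_1^{-1},\dots,\mu_{m-1},\mu_{m-1}^{-1}$ where $\lambda\in\mathbb{R}$ with $1<\lambda\le Q$ and each $\mu_i\notin\mathbb{R}$ with $|\mu_i|=1$. Then \[ \#\mathcal{F}_{m,D}(Q)\le\frac{\kappa(m,D)}{\pi\sqrt D}Q^{m-1}\log Q+O(Q^{m-1}), \] where \[ \kappa(m,D)=\begin{cases}2^{t+2m}\kappa_0(m)&\text{if $D$ is odd},\\ 3\cdot 2^{t+2m-2}\kappa_0(m)&\text{if $D$ is even},\end{cases} \] and \[ \kappa_0(m)=\begin{cases}\dfrac{2^{(m-1)(m-2)}(2^{2m}-4)^{\frac m2-1}}{\left((\frac m2-1)!\right)^2}&\text{if $m$ is even},\\[2ex] \dfrac{2^{(2m-1)(\frac{m-1}{2})}(2^{2m-1}-2)^{\frac{m-3}{2}}}{\left((\frac{m-1}{2})!\right)^2}&\text{if $m$ is odd}.\end{cases} \]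
   Context: A Salem number is a real algebraic integer $\lambda>1$ all of whose Galois conjugates other than $\lambda^{-1}$ have absolute value $1$; the set $\mathcal{F}_{m,D}(Q)$ is exactly the set of minimal polynomials of degree $2m$ of Salem numbers $\lambda\le Q$ (equivalently, Mahler measure $\le Q$) with $f(1)f(-1)\equiv -D$ in $\mathbb{Q}^\times/\mathbb{Q}^{\times2}$.
   Formalization: The case m = 1 is excluded, since there κ_0(1) contains the factor (2^1−2)^{−1} = 0^{−1} and the stated bound is undefined; the theorem is proved for all m ≥ 2. *)

(* Defs.v *)
From HB Require Import structures.
From mathcomp Require Import all_boot all_order all_algebra finmap.
From mathcomp Require Import all_classical all_reals all_analysis.
From mathcomp Require Import complex.

Set Implicit Arguments.
Unset Strict Implicit.
Unset Printing Implicit Defensive.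

Import Order.TTheory GRing.Theory Num.Theory.

Local Open Scope classical_set_scope.
Local Open Scope ring_scope.

Definition squarefree (D : nat) : Prop :=
  forall d : nat, (d ^ 2 %| D)%N -> d = 1%N.

Definition reciprocal_of (m : nat) (f : {poly int}) : Prop :=
  [/\ (size f <= (2 * m).+1)%N,
      forall k : nat, (k <= 2 * m)%N -> f`_k = f`_(2 * m - k),
      f`_0 = 1 & f`_(2 * m) = 1].

Definition root_list (R : realType) (n : nat) (lambda : R)
    (mu : 'I_n -> R[i]) : seq R[i] :=
  [:: lambda%:C; (lambda^-1)%:C]%C
    ++ [seq mu i | i : 'I_n] ++ [seq (mu i)^-1 | i : 'I_n].

Definition salem_roots (R : realType) (m : nat) (Q : R) (f : {poly int}) : Prop :=
  exists (lambda : R) (mu : 'I_(m - 1) -> R[i]),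
    [/\ 1 < lambda, lambda <= Q,
        forall i, mu i \isn't Num.real,
        forall i, `|mu i| = 1
      & uniq (root_list lambda mu) /\
        forall z : R[i],
          root (map_poly intr f) z = (z \in root_list lambda mu)].

Definition Fset (R : realType) (m D : nat) (Q : R) : set {poly int} :=
  [set f | [/\ reciprocal_of m f,
               irreducible_poly (map_poly intr f : {poly rat}),
               exists k : rat, (f.[1] * f.[-1])%:~R = - (D%:R * k ^+ 2)
             & salem_roots m Q f]].

(* The exponents are natural-number expressions: [./2] is an exact division in
   each branch, and no subtraction truncates as soon as [m >= 2].  At [m = 1]
   the formula is [0 ^ -1 / 1], hence undefined, and the value [kappa0 1]
   computed below is meaningless. *)
Definition kappa0 (R : realType) (m : nat) : R :=
  if odd m then
    2 ^+ ((2 * m - 1) * (m - 1)./2)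
      * (2 ^+ (2 * m - 1) - 2) ^+ (m - 3)./2 / (((m - 1)./2)`!%:R) ^+ 2
  else
    2 ^+ ((m - 1) * (m - 2)) * (2 ^+ (2 * m) - 4) ^+ (m./2 - 1)
      / ((m./2 - 1)`!%:R) ^+ 2.

Definition kappa (R : realType) (m D : nat) : R :=
  let t := size (primes D) in
  if odd D then 2 ^+ (t + 2 * m) * kappa0 R m
  else 3 * 2 ^+ (t + 2 * m - 2) * kappa0 R m.

(* Main.v *)
(* Write [f(x) = x^m g(x + 1/x)]. The trace polynomial [g] has one root
   [alpha = lambda + 1/lambda <= Q + 1] above [2] and all others in [(-2, 2)],
   so [a = -f(1) = -g(2)] and [b = f(-1) = |g(-2)|] are positive, at most
   [4^(m-1) (Q + 3)], and the coefficients of [g] are at most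
   [3^(m-1) (Q + 2)] in absolute value. The pair [(a, b)] and the [m - 2]
   coefficients of [g] of degrees [2, .., m-1] determine [f].
   As [a b = D k^2] with [D] squarefree, [a = d e x^2] and [b = (D/d) e y^2]
   with [d | D] and [e] prime to [D], so that there are at most
   [2^t (N / sqrt D) sum_(e <= N) 1/e] pairs bounded by [N], where [e] is odd
   when [D] is even. Finally [(2 * 3^(m-1))^(m-2) <= kappa0(m)], and [pi <= 4]
   absorbs the remaining constants. *)

Require Import Defs.
From HB Require Import structures.
From mathcomp Require Import all_boot all_order all_algebra finmap.
From mathcomp Require Import all_classical all_reals all_analysis.
From mathcomp Require Import complex.
From mathcomp Require Import zify ring lra.

Import Order.TTheory GRing.Theory Num.Theory.
Local Open Scope classical_set_scope.
Local Open Scope ring_scope.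

(** * Squarefree parts and the equation [a b = D k^2] *)

Lemma squarefree_logn (D p : nat) : squarefree D -> (logn p D <= 1)%N.
Proof.
move=> sqD; rewrite leqNgt; apply/negP => lt1.
have p_pr : prime p by move: lt1; rewrite lognE; case: (prime p).
have /sqD p1 : (p ^ 2 %| D)%N.
  rewrite pfactor_dvdn //.
  by case: D sqD lt1 => // sq0; rewrite logn0.
by rewrite p1 in p_pr.
Qed.

Lemma squarefree_dvd (d D : nat) : (d %| D)%N -> squarefree D -> squarefree d.
Proof. by move=> dD sqD e /dvdn_trans /(_ dD) /sqD. Qed.

Lemma squarefree_part (a : nat) : (0 < a)%N ->
  exists s x : nat, [/\ (0 < s)%N, (0 < x)%N, squarefree s & a = (s * x ^ 2)%N].
Proof.
elim/ltn_ind: a => a IH a0.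
case: (pselect (squarefree a)) => [sqa|].
  by exists a, 1%N; split => //; rewrite muln1.
move=> /existsNP[d /not_implyP[/dvdnP[a' aE] d1]].
have a'0 : (0 < a')%N by move: a0; rewrite aE muln_gt0 => /andP[].
have d0 : (0 < d)%N by move: a0; rewrite aE; case: (d) => //; rewrite muln0.
have lt : (a' < a)%N by rewrite aE ltn_Pmulr //; move: d0 d1; nia.
have [s [x [s0 x0 sqs a'E]]] := IH _ lt a'0.
exists s, (x * d)%N; split => //; first by rewrite muln_gt0 x0.
by rewrite aE a'E expnMn mulnA.
Qed.

(** At each prime the exponents in [u] and [v] are at most 1 and have the same parity, so they
    agree. *)
Lemma squarefree_part_uniq (u v x k : nat) : (0 < x)%N -> (0 < k)%N ->
  squarefree u -> squarefree v -> (u * x ^ 2 = v * k ^ 2)%N -> u = v.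
Proof.
move=> x0 k0 squ sqv E.
have pos w : squarefree w -> (0 < w)%N by case: w => // /(_ 0%N); rewrite dvdn0 => /(_ isT).
apply: eqn_from_log; [exact: pos | exact: pos |] => p.
have := congr1 (logn p) E.
have u0 := pos _ squ; have v0 := pos _ sqv.
rewrite !lognM ?muln_gt0 ?u0 ?v0 ?x0 ?k0 //.
have := squarefree_logn _ p squ; have := squarefree_logn _ p sqv.
lia.
Qed.

(* [e] is the gcd of the squarefree parts of [a] and [b]; it is prime to [D]. *)
Lemma mul_eq_sqf_mul_sqr (D a b k : nat) : squarefree D -> (0 < a)%N ->
    (0 < b)%N -> (a * b = D * k ^ 2)%N ->
  exists d e x y : nat, [/\ (d %| D)%N, (0 < x)%N /\ (0 < y)%N,
    (0 < e)%N && (odd e || odd D),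
    a = (d * e * x ^ 2)%N & b = (D %/ d * e * y ^ 2)%N].
Proof.
move=> sqD a0 b0 abE.
have k0 : (0 < k)%N by case: k abE => //; nia.
have [s [x [s0 x0 sqs aE]]] := squarefree_part _ a0.
have [r [y [r0 y0 sqr bE]]] := squarefree_part _ b0.
pose e := gcdn s r.
have e0 : (0 < e)%N by rewrite gcdn_gt0 s0.
have /dvdnP[d sE] : (e %| s)%N by apply: dvdn_gcdl.
have /dvdnP[c rE] : (e %| r)%N by apply: dvdn_gcdr.
have cop : coprime d c.
  rewrite /coprime -(eqn_pmul2r e0) mul1n muln_gcdl -sE -rE; exact/eqP.
have d0 : (0 < d)%N by move: s0; rewrite sE muln_gt0 => /andP[].
(* By coprimality, a prime square dividing [d * c] divides one of the two factors, hence [s] or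
   [r]. *)
have sqdc : squarefree (d * c).
  move=> q qdc; apply/eqP; apply/negPn/negP => q1.
  have [p p_pr pq] : exists2 p, prime p & (p %| q)%N.
    exists (pdiv q); rewrite ?pdiv_dvd // pdiv_prime //.
    case: q qdc q1 => [|[|]] //; rewrite dvd0n muln_eq0.
    by move: d0 r0; rewrite rE muln_gt0; lia.
  have : (p ^ 2 %| d * c)%N by apply: dvdn_trans qdc; rewrite dvdn_exp2r.
  case: (boolP (p %| d)%N) => pd.
    have pc : coprime (p ^ 2) c by rewrite coprimeXl // (coprime_dvdl pd).
    rewrite Gauss_dvdl // => p2d.
    have /sqs p1 : (p ^ 2 %| s)%N by rewrite sE dvdn_mulr.
    by rewrite p1 in p_pr.
  have pc : coprime (p ^ 2) d by rewrite coprimeXl // prime_coprime.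
  rewrite Gauss_dvdr // => p2d.
  have /sqr p1 : (p ^ 2 %| r)%N by rewrite rE dvdn_mulr.
  by rewrite p1 in p_pr.
have DE : (d * c)%N = D.
  apply: (@squarefree_part_uniq _ _ (e * x * y) k) => //.
    by rewrite !muln_gt0 e0 x0.
  rewrite -abE aE bE sE rE !expnMn; lia.
exists d, e, x, y; split => //.
- by rewrite -DE dvdn_mulr.
(* If [e] is even, then [d] and [c] are odd because [s = d e] and [r = c e] are squarefree, so
   [D = d c] is odd. *)
- rewrite e0 /= -DE oddM; case: (boolP (odd e)) => //= eev.
  have two q w : q = (w * e)%N -> squarefree q -> odd w.
    move=> qE sqq; apply/negPn/negP => wev.
    suff /sqq : (2 ^ 2 %| q)%N by [].
    by rewrite qE expnS expn1 dvdn_mul // dvdn2.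
  by rewrite (two _ _ sE sqs) (two _ _ rE sqr).
- by rewrite aE sE.
- by rewrite -DE mulKn // bE rE.
Qed.

(** A divisor of [D] is determined by the primes of [D] that divide it, which [phi] records. *)
Lemma size_divisors_squarefree (D : nat) : (0 < D)%N -> squarefree D ->
  (size (divisors D) <= 2 ^ size (primes D))%N.
Proof.
move=> D0 sqD.
pose t := size (primes D).
pose phi (d : nat) := [ffun i : 'I_t => (nth 0%N (primes D) i %| d)%N].
have inj : {in divisors D &, injective phi}.
  move=> d c; rewrite -!dvdn_divisors // => dD cD /ffunP E.
  have d0 := dvdn_gt0 D0 dD; have c0 := dvdn_gt0 D0 cD.
  apply: eqn_from_log => // p.
  case: (boolP (p \in primes D)) => [pD|pD]; last first.
    have nlog q : (q %| D)%N -> logn p q = 0%N.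
      move=> qD; apply/eqP; rewrite -leqn0 -(_ : logn p D = 0%N).
        by apply: dvdn_leq_log.
      by apply/eqP; rewrite -leqn0 leqNgt logn_gt0.
    by rewrite !nlog.
  have lt : (index p (primes D) < t)%N by rewrite index_mem.
  have := E (Ordinal lt); rewrite !ffunE /= nth_index // => pE.
  have p_pr : prime p by move: pD; rewrite mem_primes => /andP[].
  have := squarefree_logn _ p (squarefree_dvd _ _ dD sqD).
  have := squarefree_logn _ p (squarefree_dvd _ _ cD sqD).
  move: pE.
  have := pfactor_dvdn 1 p_pr d0; have := pfactor_dvdn 1 p_pr c0.
  rewrite !expn1 => -> ->; lia.
rewrite -(size_map phi).
have -> : (2 ^ t = #|{ffun 'I_t -> bool}|)%N by rewrite card_ffun card_bool card_ord.
rewrite -(card_uniqP _) ?max_card // map_inj_in_uniq //.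
exact: divisors_uniq.
Qed.

(** * Dickson polynomials and the trace polynomial *)

(** Dickson polynomials of the first kind with parameter 1, which send [x + 1/x] to [x^k + x^-k].
    Two consecutive ones are carried along because the recurrence has order two. *)
Fixpoint dickson_pair (k : nat) : {poly int} * {poly int} :=
  if k is k'.+1 then
    let: (p, q) := dickson_pair k' in (q, 'X * q - p)
  else (2%:P, 'X).

Definition dickson (k : nat) : {poly int} := (dickson_pair k).1.

Lemma dicksonSS (k : nat) : dickson k.+2 = 'X * dickson k.+1 - dickson k.
Proof. by rewrite /dickson /=; case: (dickson_pair k). Qed.

Lemma dickson_coef (k : nat) :
  (forall j, (k < j)%N -> (dickson k)`_j = 0) /\
  ((0 < k)%N -> (dickson k)`_k = 1).
Proof.
suff: forall k, ((forall j, (k < j)%N -> (dickson k)`_j = 0) /\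
    ((0 < k)%N -> (dickson k)`_k = 1)) /\
    ((forall j, (k.+1 < j)%N -> (dickson k.+1)`_j = 0) /\
    (dickson k.+1)`_k.+1 = 1) by move=> /(_ k)[].
elim=> [|{}k [[IH0 _] [IH1 IH2]]].
  split; split => //; rewrite /dickson /=.
  - by case=> // j _; rewrite coefC.
  - by case=> [|[|j]] // _; rewrite coefX.
  - by rewrite coefX.
split; split => //.
- move=> [|j] // lt; rewrite dicksonSS coefB coefXM /= IH1 // IH0 ?subr0 //.
  by lia.
- by rewrite dicksonSS coefB coefXM /= IH2 IH0 ?subr0.
Qed.

Lemma dickson_horner (F : fieldType) (z : F) (k : nat) : z != 0 ->
  (map_poly intr (dickson k)).[z + z^-1] = z ^+ k + z ^- k.
Proof.
move=> z0.
suff: forall k, (map_poly intr (dickson k)).[z + z^-1] = z ^+ k + z ^- k /\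
  (map_poly intr (dickson k.+1)).[z + z^-1] = z ^+ k.+1 + z ^- k.+1
  by move=> /(_ k)[].
elim=> [|{}k [IH0 IH1]].
  rewrite /dickson /= map_polyC map_polyX !hornerE expr0 invr1.
  by split => //; rewrite -[2]/(1 + 1)%Z rmorphD.
split => //; rewrite dicksonSS rmorphB rmorphM /= map_polyX !hornerE IH0 IH1.
rewrite !exprS; field; by rewrite z0 /= expf_neq0.
Qed.

(** This is the [g] with [f(x) = x^m g(x + 1/x)], read off the upper half of the coefficients. The
    middle coefficient stands apart because [dickson 0] is 2 and not 1. *)
Definition trace_poly (m : nat) (f : {poly int}) : {poly int} :=
  (f`_m)%:P + \sum_(k < m) f`_(m + k.+1) *: dickson k.+1.

Lemma trace_poly_size (m : nat) (f : {poly int}) :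
  (size (trace_poly m f) <= m.+1)%N.
Proof.
apply/leq_sizeP => j lt; rewrite coefD coefC (gtn_eqF (leq_ltn_trans _ lt)) // add0r.
rewrite coef_sum big1 // => i _; rewrite coefZ (proj1 (dickson_coef _)) ?mulr0 //.
exact: leq_ltn_trans (ltn_ord i) lt.
Qed.

Lemma trace_poly_lead (m : nat) (f : {poly int}) :
  (0 < m)%N -> (trace_poly m f)`_m = f`_(2 * m).
Proof.
case: m => // m _; rewrite coefD coefC /= add0r coef_sum big_ord_recr /=.
rewrite big1 ?add0r => [|i _].
  by rewrite coefZ (proj2 (dickson_coef _)) // mulr1 mul2n addnn.
by rewrite coefZ (proj1 (dickson_coef _)) ?mulr0 // ltnS.
Qed.

Lemma trace_poly_horner (F : fieldType) (z : F) (m : nat) (f : {poly int}) :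
    z != 0 -> reciprocal_of m f ->
  (map_poly intr f).[z] =
  z ^+ m * (map_poly intr (trace_poly m f)).[z + z^-1].
Proof.
move=> z0 [sf pal _ _].
rewrite (@horner_coef_wide _ (2 * m).+1); last exact: leq_trans (size_poly _ _) sf.
under eq_bigr do rewrite coef_map /=.
rewrite /trace_poly rmorphD raddf_sum /= map_polyC !hornerE horner_sum mulrDr.
have -> : \sum_(i < (2 * m).+1) (f`_i)%:~R * z ^+ i =
   \sum_(i < m) (f`_i)%:~R * z ^+ i + \sum_(i < m.+1) (f`_(m + i))%:~R * z ^+ (m + i).
  have -> : (2 * m).+1 = (m + m.+1)%N by rewrite mul2n -addnn addnS.
  by rewrite big_split_ord.
(* Reversing the lower half pairs the exponent [m - i - 1] with [m + i + 1], where [f] has the same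
   coefficient. *)
rewrite (reindex_inj rev_ord_inj) /= big_ord_recl /= addn0 addrCA mulrC.
congr (_ + _).
rewrite -big_split /= mulr_sumr; apply: eq_bigr => i _.
rewrite map_polyZ /= hornerZ dickson_horner // /bump /= add1n.
have lei := ltn_ord i.
rewrite (pal (m - i.+1)%N); last by lia.
have -> : (2 * m - (m - i.+1) = m + i.+1)%N by lia.
have zm : z ^+ m = z ^+ (m - i.+1) * z ^+ i.+1 by rewrite -exprD subnK.
rewrite exprD zm; field; exact: expf_neq0.
Qed.

(** * Bounds for harmonic sums *)

(** This is [ln (1 + u) <= u] at [u = x / y - 1]. *)
Lemma ln_sub_ge (R : realType) (x y : R) : 0 < x -> 0 < y ->
  (y - x) / y <= ln y - ln x.
Proof.
move=> x0 y0; have r0 : 0 < x / y by rewrite divr_gt0.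
have : ln (1 + (x / y - 1)) <= x / y - 1 by apply: le_ln1Dx; lra.
rewrite addrC subrK ln_div ?posrE // mulrBl divff ?gt_eqF //; lra.
Qed.

Lemma harmonic_le_ln (R : realType) (N : nat) :
  \sum_(1 <= e < N.+1) (e%:R : R)^-1 <= 1 + ln N%:R.
Proof.
elim: N => [|[|N] IH].
- by rewrite big_geq // ln0 // addr0.
- by rewrite big_nat1 invr1 ln1 addr0.
rewrite big_nat_recr //=.
have := @ln_sub_ge R N.+1%:R N.+2%:R (ltr0Sn _ _) (ltr0Sn _ _).
rewrite -natrB // subSnn mul1r lerBrDr => h.
apply: le_trans (lerD IH (lexx _)) _; rewrite -addrA lerD2l addrC; exact: h.
Qed.

(** Consecutive odd numbers differ by 2, so [2/(2k+3) <= ln (2k+3) - ln (2k+1)], whence the factor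
    1/2. A positive even [N] reduces to [N - 1]. *)
Lemma odd_harmonic_le_ln (R : realType) (N : nat) :
  \sum_(1 <= e < N.+1 | odd e) (e%:R : R)^-1 <= 1 + ln N%:R / 2.
Proof.
have Hodd k : \sum_(1 <= e < k.*2.+2 | odd e) (e%:R : R)^-1
    <= 1 + ln k.*2.+1%:R / 2.
  elim: k => [|k IH]; first by rewrite big_mkcond big_nat1 /= invr1 ln1; lra.
  rewrite doubleS big_mkcond.
  rewrite (@big_nat_recr _ _ _ k.*2.+3) //= (@big_nat_recr _ _ _ k.*2.+2) //=.
  rewrite -big_mkcond /= odd_double /= addr0.
  have := @ln_sub_ge R k.*2.+1%:R k.*2.+3%:R (ltr0Sn _ _) (ltr0Sn _ _).
  rewrite -natrB //; last by lia.
  have -> : (k.*2.+3 - k.*2.+1 = 2)%N by lia.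
  move: IH; set s := \sum_(_ <= _ < _ | _) _; move: s => s.
  move: (ln _) (ln _) (k.*2.+3%:R^-1) => l l' i; lra.
rewrite -[N in ln N%:R]odd_double_half -[N in index_iota _ N.+1]odd_double_half.
case: (odd N) => /=; first by rewrite add1n.
rewrite add0n; case: (N./2) => [|k].
  by rewrite big_geq // ln0 //; lra.
rewrite doubleS big_mkcond big_nat_recr //= negbK odd_double addr0 -big_mkcond /=.
apply: le_trans (Hodd k) _; rewrite lerD2l ler_pM2r ?invr_gt0 //.
by rewrite ler_ln ?posrE // ler_nat.
Qed.

(** * Enumeration of the pairs with product [D k^2] *)

Definition nsqrt (k : nat) : nat := (\max_(x < k.+1 | x ^ 2 <= k) x)%N.

Lemma nsqrt_sqr_le (k : nat) : (nsqrt k ^ 2 <= k)%N.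
Proof.
rewrite /nsqrt; elim/big_ind: _ => // x y hx hy.
by rewrite /maxn; case: ifP.
Qed.

Lemma leq_nsqrt (k x : nat) : (x ^ 2 <= k)%N -> (x <= nsqrt k)%N.
Proof.
move=> xk; have ltx : (x < k.+1)%N by case: x xk => // x; nia.
exact: (@leq_bigmax_cond _ _ (fun i : 'I_k.+1 => i : nat) (Ordinal ltx)).
Qed.

(** As [e] is not confined to squarefree values, a pair may be listed several times; the list serves
    only for an upper bound. *)
Definition square_product_pairs (D N : nat) : seq (nat * nat) :=
  flatten [seq flatten [seq
    [seq (d * e * x ^ 2, D %/ d * e * y ^ 2)%N
      | x <- iota 1 (nsqrt (N %/ (d * e))),
        y <- iota 1 (nsqrt (N %/ (D %/ d * e)))]
    | e <- index_iota 1 N.+1 & odd e || odd D] | d <- divisors D].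

Lemma mem_square_product_pairs (D N a b k : nat) :
    (0 < D)%N -> squarefree D -> (0 < a <= N)%N -> (0 < b <= N)%N ->
    (a * b = D * k ^ 2)%N ->
  (a, b) \in square_product_pairs D N.
Proof.
move=> D0 sqD /andP[a0 aN] /andP[b0 bN] abE.
have [d [e [x [y [dD [x0 y0] /andP[e0 eD] aE bE]]]]] :=
  mul_eq_sqf_mul_sqr _ _ _ _ sqD a0 b0 abE.
have d0 := dvdn_gt0 D0 dD.
have c0 : (0 < D %/ d)%N by rewrite divn_gt0 // dvdn_leq.
apply/flatten_mapP; exists d; first by rewrite -dvdn_divisors.
apply/flatten_mapP; exists e.
  rewrite mem_filter eD mem_index_iota e0 ltnS /=.
  by apply: leq_trans aN; rewrite aE mulnAC leq_pmull // muln_gt0 d0 expn_gt0 x0.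
apply/allpairsP; exists (x, y); rewrite /= aE bE !mem_iota x0 y0 !add1n !ltnS.
by split => //; apply: leq_nsqrt; rewrite leq_divRL ?muln_gt0 ?d0 ?c0 // mulnC -?aE -?bE.
Qed.

(** For fixed [d] and [e], the inequalities [d e u^2 <= N] and [(D/d) e v^2 <= N] multiply to
    [u v <= N / (e sqrt D)], which does not involve [d]. Summing over [e] gives a harmonic sum,
    restricted to odd [e] when [D] is even; summing over [d] gives the power of 2. *)
Lemma size_square_product_pairs (R : realType) (D N : nat) :
    (0 < D)%N -> squarefree D ->
  (size (square_product_pairs D N))%:R <=
  2 ^+ size (primes D) * (N%:R / Num.sqrt D%:R)
    * (1 + (if odd D then 1 else 2^-1) * ln N%:R) :> R.
Proof.
move=> D0 sqD.
have sD0 : 0 < Num.sqrt (D%:R : R) by rewrite sqrtr_gt0 ltr0n.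
set B := N%:R / _.
have B0 : 0 <= B by rewrite divr_ge0 // ltW.
rewrite size_flatten /shape sumnE !big_map natr_sum.
apply: (@le_trans _ _ (\sum_(d <- divisors D)
    \sum_(1 <= e < N.+1 | odd e || odd D) B / (e%:R : R))).
  rewrite big_seq [leRHS]big_seq; apply: ler_sum => d.
  rewrite -dvdn_divisors // => dD.
  have d0 := dvdn_gt0 D0 dD.
  have c0 : (0 < D %/ d)%N by rewrite divn_gt0 // dvdn_leq.
  rewrite size_flatten /shape sumnE !big_map big_filter natr_sum.
  rewrite big_nat_cond [leRHS]big_nat_cond; apply: ler_sum => e /andP[/andP[e0 _] _].
  rewrite size_allpairs !size_iota.
  set u := nsqrt _; set v := nsqrt _.
  have hu : (d * e * u ^ 2 <= N)%N.
    by rewrite mulnC -leq_divRL ?muln_gt0 ?d0 // nsqrt_sqr_le.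
  have hv : (D %/ d * e * v ^ 2 <= N)%N.
    by rewrite mulnC -leq_divRL ?muln_gt0 ?c0 // nsqrt_sqr_le.
  have huv : (D * (e * (u * v)) ^ 2 <= N ^ 2)%N.
    have := leq_mul hu hv; rewrite -{2}(divnK dD) !expnMn; nia.
  rewrite ler_pdivlMr ?ltr0n // ler_pdivlMr //.
  rewrite -(@ler_pXn2r _ 2) ?nnegrE ?mulr_ge0 ?ler0n ?(ltW sD0) //.
  rewrite !exprMn sqr_sqrtr ?ler0n // -!natrX -!natrM ler_nat.
  by move: huv; rewrite !expnMn; lia.
rewrite big_const_seq count_predT iter_addr_0 -[leLHS]mulr_natl -mulr_sumr -[leRHS]mulrA.
apply: ler_pM.
- by [].
- by rewrite mulr_ge0 // sumr_ge0.
- by rewrite -natrX ler_nat size_divisors_squarefree.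
rewrite ler_wpM2l //.
case: ifP => oD.
  by rewrite mul1r; under eq_bigl do rewrite orbT; exact: harmonic_le_ln.
by rewrite mulrC; under eq_bigl do rewrite orbF; exact: odd_harmonic_le_ln.
Qed.

(** * Roots of the trace polynomial *)

(** Multiplication by ['X - z] shifts the coefficients and subtracts [z] times them, so a uniform
    bound grows by at most the factor [1 + |z|]. *)
Lemma prod_XsubC_coef_le (R : numDomainType) (rs : seq R) (k : nat) :
  `|(\prod_(z <- rs) ('X - z%:P))`_k| <= \prod_(z <- rs) (1 + `|z|).
Proof.
elim: rs k => [|z rs IH] k.
  by rewrite !big_nil coef1; case: (k == 0%N); rewrite ?normr1 ?normr0.
rewrite !big_cons mulrBl coefB coefXM coefCM mulrDl mul1r.
apply: le_trans (ler_normB _ _) _; apply: lerD; last first.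
  by rewrite normrM ler_wpM2l.
case: k => [|k] /=; last exact: IH.
by rewrite normr0; apply: prodr_ge0 => i _; rewrite addr_ge0.
Qed.

(** On the unit circle the inverse is the conjugate, and a nonzero imaginary part leaves a real part
    of absolute value below 1. *)
Lemma unit_circle_trace (R : realType) (z : R[i]) : `|z| = 1 ->
  z + z^-1 = (2 * complex.Re z)%:C%C /\
  (z \isn't Num.real -> `|2 * complex.Re z| < 2).
Proof.
case: z => a b; rewrite normc_def /= => /complexI n1.
have h : a ^+ 2 + b ^+ 2 = 1.
  have : 0 <= a ^+ 2 + b ^+ 2 by rewrite addr_ge0 ?sqr_ge0.
  by move=> /sqr_sqrtr <-; rewrite n1 expr1n.
split.
  have -> : ((a +i* b)^-1 = a -i* b)%C.
    apply: mulr1_eq; apply/eqP; rewrite eq_complex /=.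
    by apply/andP; split; apply/eqP; lra.
  by apply/eqP; rewrite eq_complex /=; apply/andP; split; apply/eqP; lra.
rewrite complex_real => b0; have b2 : 0 < b ^+ 2 by rewrite exprn_even_gt0.
rewrite ltr_norml; apply/andP; split; nra.
Qed.

(** The difference of the two sums factors as [(z - w) (1 - 1/(z w))]. *)
Lemma add_inv_inj (F : fieldType) (z w : F) : z != 0 -> w != 0 ->
  z + z^-1 = w + w^-1 -> z = w \/ z = w^-1.
Proof.
move=> z0 w0 E.
have /eqP : (z - w) * (1 - (z * w)^-1) = 0.
  transitivity ((z + z^-1) - (w + w^-1)); last by rewrite E subrr.
  by field; rewrite z0 w0.
rewrite mulf_eq0 !subr_eq0 => /orP[/eqP ->|/eqP zw]; [by left | right].
have zw1 : z * w = 1 by rewrite -[z * w]invrK -zw invr1.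
by rewrite -[z](mulfK w0) zw1 mul1r.
Qed.

(** A root [z] of [f] makes [z + 1/z] a root of the trace polynomial. This yields [m] distinct real
    roots, which exhaust a monic polynomial of degree [m]. *)
Lemma trace_poly_roots (R : realType) (m : nat) (Q : R) (f : {poly int}) :
    (0 < m)%N -> reciprocal_of m f -> salem_roots m Q f ->
  exists (alpha : R) (ts : seq R), [/\ 2 < alpha, alpha <= Q + 1,
    size ts = (m - 1)%N, all (fun t => `|t| < 2) ts &
    map_poly intr (trace_poly m f) = \prod_(z <- alpha :: ts) ('X - z%:P)].
Proof.
move=> m0 rf [lam [mu [lam1 lamQ munr mu1 [uniq_rs rootE]]]].
have lam0 : 0 < lam by lra.
have lamV : 0 < lam^-1 < 1 by rewrite invr_gt0 lam0 invf_lt1.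
have lamVK : lam * lam^-1 = 1 by rewrite divff // gt_eqF.
pose t i := 2 * complex.Re (mu i).
have mu0 i : mu i != 0 by rewrite -normr_eq0 mu1 oner_eq0.
have tE i : (t i)%:C%C = mu i + (mu i)^-1.
  by rewrite (proj1 (unit_circle_trace _ _ (mu1 i))).
have t2 i : `|t i| < 2 by exact: (proj2 (unit_circle_trace _ _ (mu1 i))).
pose alpha := lam + lam^-1.
have alpha2 : 2 < alpha.
  (* Indeed [alpha - 2 = (lam - 1)^2 / lam]. *)
  have : 0 < (lam - 1) ^+ 2 by rewrite exprn_gt0 // subr_gt0.
  rewrite /alpha; nra.
set G := map_poly intr (trace_poly m f).
have mapG : map_poly (real_complex R) G = map_poly intr (trace_poly m f).
  by rewrite -map_poly_comp; apply: eq_map_poly => x /=; rewrite rmorph_int.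
have rootG (z : R[i]) (x : R) : z != 0 -> x%:C%C = z + z^-1 ->
    z \in root_list lam mu -> root G x.
  move=> z0 xE; rewrite -rootE /root (trace_poly_horner _ _ _ _ z0 rf) -xE.
  by rewrite -mapG mulf_eq0 expf_eq0 (negPf z0) andbF horner_map /= fmorph_eq0.
have ts_inj : injective t.
  move=> i j tij; have := congr1 (real_complex R) tij; rewrite /= !tE.
  case/(add_inv_inj _ _ _ (mu0 i) (mu0 j)).
    move: uniq_rs; rewrite !cat_uniq => /and3P[_ _ /and3P[/injectiveP]].
    by move=> + _ _ => /[apply].
  (* Here [mu i] is the inverse of [mu j], so it would lie both among the [mu] and among their
     inverses, against [uniq_rs]. *)
  move=> E; move: uniq_rs; rewrite !cat_uniq => /and3P[_ _ /and3P[_ /hasPn]].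
  move=> /(_ (mu i)) H _.
  have /H /negP[] : mu i \in [seq (mu k)^-1 | k : 'I_(m - 1)].
    by rewrite E; apply: (map_f (fun k => (mu k)^-1)); rewrite mem_enum.
  by apply: (map_f mu); rewrite mem_enum.
exists alpha, [seq t i | i : 'I_(m - 1)]; split => //.
- by rewrite /alpha; lra.
- by rewrite size_image card_ord.
- by apply/allP => x /mapP[i _ ->].
have [_ _ _ f2m] := rf.
have Gm : G`_m = 1 by rewrite coef_map /= trace_poly_lead // f2m.
have sG : size G = m.+1.
  apply/eqP; rewrite eqn_leq (leq_trans (size_poly _ _) (trace_poly_size _ _)) /=.
  by rewrite ltnNge; apply/negP => /leq_sizeP /(_ m (leqnn _)) /eqP; rewrite Gm oner_eq0.
rewrite [LHS](@all_roots_prod_XsubC _ _ (alpha :: [seq t i | i : 'I_(m - 1)])).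
- by rewrite /lead_coef sG /= Gm scale1r.
- by rewrite sG /= size_image card_ord; lia.
- rewrite /=; apply/andP; split.
    apply: (rootG lam%:C%C); last by rewrite !inE eqxx.
      by rewrite fmorph_eq0 gt_eqF.
    by rewrite rmorphD /= fmorphV.
  apply/allP => x /mapP[i _ ->]; apply: (rootG (mu i)) => //.
  rewrite !mem_cat (_ : mu i \in [seq mu i | i : 'I_(m - 1)]) ?orbT //.
  by apply: (map_f mu); rewrite mem_enum.
- rewrite uniq_rootsE /= map_inj_uniq ?enum_uniq // andbT.
  apply/negP => /mapP[i _ aE]; have := t2 i.
  by rewrite -aE ltr_norml; lra.
Qed.

(** * Encoding and counting the polynomials *)

Lemma finite_card_inj (T U : choiceType) (A : set T) (psi : T -> U)
    (s : seq U) :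
    (forall x y, A x -> A y -> psi x = psi y -> x = y) ->
    (forall x, A x -> psi x \in s) ->
  finite_set A /\ (#|` fset_set A|%fset <= size s)%N.
Proof.
move=> inj sub.
have finA : finite_set A.
  have injA : {in A &, injective psi}.
    by move=> x y; rewrite !inE => Ax Ay; exact: inj.
  rewrite -(eq_finite_set (inj_card_eq injA)).
  apply: (sub_finite_set _ (finite_seq s)) => y [x Ax <-]; exact: sub.
split => //; rewrite cardfE cardE -(size_map val) -(size_map psi).
apply: uniq_leq_size.
  rewrite map_inj_in_uniq; first by rewrite map_inj_uniq ?enum_uniq //; exact: val_inj.
  move=> x y /mapP[x' _ ->] /mapP[y' _ ->]; have := valP x'; have := valP y'.
  by rewrite !in_fset_set // !inE => Ay Ax; exact: inj.
move=> y /mapP[x /mapP[x' _ ->] ->]; have := valP x'.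
rewrite in_fset_set // inE; exact: sub.
Qed.

(** At [z = 1] and [z = -1] the sum [z + 1/z] is 2 and -2. The identity is read in [rat] because
    [trace_poly_horner] works over a field. *)
Lemma trace_poly_horner_int (m : nat) (f : {poly int}) : reciprocal_of m f ->
  (trace_poly m f).[2] = f.[1] /\ (-1) ^+ m * (trace_poly m f).[-2] = f.[-1].
Proof.
move=> rf; split; apply/(intr_inj (R := rat)).
  have := trace_poly_horner rat 1 m f (oner_neq0 _) rf.
  by rewrite expr1n mul1r invr1 -!(horner_map intr) /= rmorphD rmorph1.
have := trace_poly_horner rat (-1) m f _ rf.
rewrite oppr_eq0 oner_eq0 invrN1 => /(_ isT).
by rewrite rmorphM rmorphXn rmorphN1 -!(horner_map intr) /= !rmorphN rmorphD rmorph1 opprD.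
Qed.

(** The trace polynomial fixes the values of [f] at all nonzero points, so [f - g] vanishes at more
    positive integers than its degree allows. *)
Lemma trace_poly_inj (m : nat) (f g : {poly int}) :
  reciprocal_of m f -> reciprocal_of m g ->
  trace_poly m f = trace_poly m g -> f = g.
Proof.
move=> rf rg E; apply/eqP; rewrite -subr_eq0; apply/eqP.
apply: (map_inj_poly (f := intr : int -> rat)) => //; first exact: intr_inj.
rewrite rmorph0.
apply: (@roots_geq_poly_eq0 _ _ [seq (n.+1%:R : rat) | n <- iota 0 (size (f - g))]).
- apply/allP => x /mapP[n _ ->].
  rewrite /root rmorphB hornerD hornerN.
  have n0 : (n.+1%:R : rat) != 0 by rewrite pnatr_eq0.
  by rewrite (trace_poly_horner _ _ _ f n0 rf) (trace_poly_horner _ _ _ g n0 rg) E subrr.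
- rewrite map_inj_uniq ?iota_uniq // => i j /eqP.
  by rewrite eqr_nat eqSS => /eqP.
- by rewrite size_map size_iota size_poly.
Qed.

(* The values at 1 and -1 recover the two lowest coefficients of the trace
   polynomial. *)
Lemma reciprocal_eq (m : nat) (f g : {poly int}) : (1 < m)%N ->
    reciprocal_of m f -> reciprocal_of m g ->
    f.[1] = g.[1] -> f.[-1] = g.[-1] ->
    (forall k, (2 <= k < m)%N -> (trace_poly m f)`_k = (trace_poly m g)`_k) ->
  f = g.
Proof.
move=> m1 rf rg E1 EN1 Ek; apply: (trace_poly_inj _ _ _ rf rg).
have [f1 fN1] := trace_poly_horner_int _ _ rf.
have [g1 gN1] := trace_poly_horner_int _ _ rg.
have D1 : (trace_poly m f - trace_poly m g).[2] = 0.
  by rewrite hornerD hornerN f1 g1 E1 subrr.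
have DN1 : (trace_poly m f - trace_poly m g).[-2] = 0.
  apply/eqP; rewrite hornerD hornerN subr_eq0; apply/eqP.
  by apply: (@mulfI _ ((-1) ^+ m)); rewrite ?signr_eq0 // fN1 gN1.
apply/eqP; rewrite -subr_eq0; apply/eqP.
set d := _ - _ in D1 DN1 *.
(* Below [m] this is the hypothesis, at [m] both coefficients are 1, and above [m] both vanish. *)
have hd k : (2 <= k)%N -> d`_k = 0.
  move=> k2; rewrite coefB; case: (ltngtP k m) => km.
  - by rewrite Ek ?subrr // k2.
  - by rewrite !nth_default ?subrr //; exact: leq_trans (trace_poly_size _ _) km.
  - rewrite km !trace_poly_lead ?(ltnW m1) //.
    by case: rf => _ _ _ ->; case: rg => _ _ _ ->; rewrite subrr.
have sd : (size d <= 2)%N by apply/leq_sizeP.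
move: D1 DN1; rewrite !(horner_coef_wide _ sd) !big_ord_recr !big_ord0 /= !expr0 !expr1 !mulr1.
move=> D1 DN1.
(* The two equations read [d0 + 2 d1 = 0] and [d0 - 2 d1 = 0]. *)
have [d0 d1] : d`_0 = 0 /\ d`_1 = 0.
  by move: D1 DN1; move: (d`_0 : int) (d`_1 : int) => x y; lia.
by apply/polyP => -[|[|k]]; rewrite coef0 // hd.
Qed.

(** The squared denominator of [k] is coprime to the squared numerator, so it divides [D]; as [D] is
    squarefree, [k] is an integer. *)
Lemma sqf_mul_sqr_rat (D A : nat) (k : rat) : squarefree D ->
  A%:R = D%:R * k ^+ 2 -> exists n : nat, A = (D * n ^ 2)%N.
Proof.
move=> sqD E.
have E2 : (A * `|denq k| ^ 2 = D * `|numq k| ^ 2)%N.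
  apply/eqP; rewrite -(eqr_nat rat) (natrM _ A) (natrM _ D) !natrX E.
  have dz : (denq k)%:~R != 0 :> rat by rewrite intr_eq0 denq_neq0.
  have n2 z : (`|z|%N%:R : rat) ^+ 2 = z%:~R ^+ 2.
    by rewrite natr_absz intr_norm real_normK ?num_real.
  by rewrite !n2 -{1}(divq_num_den k); apply/eqP; field.
have cop : coprime (`|denq k| ^ 2) (`|numq k| ^ 2).
  by rewrite coprimeXl // coprimeXr // coprime_sym coprime_num_den.
have /sqD d1 : (`|denq k| ^ 2 %| D)%N.
  by rewrite -(Gauss_dvdl _ cop) -E2 dvdn_mull.
by exists `|numq k|%N; rewrite -E2 d1 exp1n muln1.
Qed.

Lemma prodr_seq_gt0_le (R : realDomainType) (T : eqType) (s : seq T)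
    (F : T -> R) (c : R) : {in s, forall x, 0 < F x <= c} ->
  0 < \prod_(x <- s) F x <= c ^+ size s.
Proof.
elim: s => [|x s IH] Fc; first by rewrite big_nil expr0 ltr01 lexx.
have /andP[x0 xc] := Fc x (mem_head _ _).
have /andP[s0 sc] : 0 < \prod_(x <- s) F x <= c ^+ size s.
  by apply: IH => y ys; apply: Fc; rewrite inE ys orbT.
by rewrite big_cons exprS mulr_gt0 //= ler_pM // ltW.
Qed.

(** With [z] over the roots of the trace polynomial, the values are the products of [2 - z], up to
    sign, and of [2 + z], and the coefficients are at most the product of [1 + |z|]. A root in
    [(-2, 2)] contributes at most 4, 4 and 3 respectively. *)
Lemma salem_bounds (R : realType) (m : nat) (Q : R) (f : {poly int}) :
    (0 < m)%N -> reciprocal_of m f -> salem_roots m Q f ->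
  [/\ 0 < - (f.[1])%:~R :> R /\ - (f.[1])%:~R <= 4 ^+ (m - 1) * (Q + 3),
      0 < (f.[-1])%:~R :> R /\ (f.[-1])%:~R <= 4 ^+ (m - 1) * (Q + 3) &
      forall k, `|(trace_poly m f)`_k|%:~R <= 3 ^+ (m - 1) * (Q + 2)].
Proof.
move=> m0 rf sf.
have [alpha [ts [a2 aQ sts /allP ts2 GE]]] := trace_poly_roots _ _ _ _ m0 rf sf.
have [f1 fN1] := trace_poly_horner_int _ _ rf.
have q0 : 0 < 4 ^+ (m - 1) :> R by rewrite exprn_gt0.
split.
- have -> : - (f.[1])%:~R = (alpha - 2) * \prod_(t <- ts) (2 - t) :> R.
    rewrite -f1 -horner_map GE /= horner_prod big_cons hornerXsubC -mulNr opprB.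
    by congr (_ * _); apply: eq_bigr => t _; rewrite hornerXsubC.
  have /andP[p0 p4] : 0 < \prod_(t <- ts) (2 - t) <= 4 ^+ size ts.
    apply: prodr_seq_gt0_le => t /ts2; rewrite ltr_norml; lra.
  rewrite sts in p4; rewrite mulr_gt0 ?subr_gt0 //; split => //.
  rewrite mulrC ler_pM //; lra.
- have -> : (f.[-1])%:~R = (alpha + 2) * \prod_(t <- ts) (2 + t) :> R.
    rewrite -fN1 rmorphM rmorphXn rmorphN1 -horner_map GE /= horner_prod.
    have -> : m = size (alpha :: ts) by rewrite /= sts; lia.
    rewrite [alpha + 2]addrC -(big_cons _ _ alpha ts xpredT (fun z => 2 + z)).
    (* The sign [(-1)^m] is spread over the [m] factors and turns each [-2 - z] into [2 + z]. *)
    elim: (alpha :: ts) => [|z s IH]; first by rewrite !big_nil mulr1.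
    rewrite !big_cons -IH hornerXsubC /= exprS.
    rewrite (_ : (-2)%:~R = -2 :> R) //; ring.
  have /andP[p0 p4] : 0 < \prod_(t <- ts) (2 + t) <= 4 ^+ size ts.
    apply: prodr_seq_gt0_le => t /ts2; rewrite ltr_norml; lra.
  rewrite sts in p4; split; first by rewrite mulr_gt0 //; lra.
  rewrite mulrC ler_pM //; lra.
- move=> k; rewrite intr_norm -(coef_map intr) GE.
  apply: le_trans (prod_XsubC_coef_le _ _ _) _; rewrite big_cons.
  have /andP[p0 p3] : 0 < \prod_(t <- ts) (1 + `|t|) <= 3 ^+ size ts.
    by apply: prodr_seq_gt0_le => t /ts2 t2; have := normr_ge0 t; lra.
  rewrite sts in p3; rewrite mulrC ler_pM //; first exact: ltW.
  rewrite ger0_norm; lra.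
Qed.

Lemma Fset_card_le (R : realType) (m D : nat) (Q : R) :
    (1 < m)%N -> (0 < D)%N -> squarefree D -> 1 < Q ->
    let N := Num.truncn (4 ^+ (m - 1) * (Q + 3)) in
    let M := Num.truncn (3 ^+ (m - 1) * (Q + 2)) in
  finite_set (Fset m D Q) /\
  (#|` fset_set (Fset m D Q)|%fset
     <= size (square_product_pairs D N) * (2 * M).+1 ^ (m - 2))%N.
Proof.
move=> m1 D0 sqD Q1 N M.
(* The absolute values lose nothing because the signs of [f(1)] and [f(-1)] are fixed. Adding [M]
   moves the coefficients from [[-M, M]] to [[0, 2M]], where [inord] is faithful. *)
pose psi (f : {poly int}) := (`|f.[1]|%N, `|f.[-1]|%N,
  [ffun i : 'I_(m - 2) => inord `|(trace_poly m f)`_(i + 2) + M%:Z| : 'I_(2 * M).+1]).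
have m0 : (0 < m)%N := ltnW m1.
have coef_M f k : Fset m D Q f -> `|(trace_poly m f)`_k| <= M%:Z.
  case=> rf _ _ sf; have [_ _ /(_ k)] := salem_bounds _ _ _ _ m0 rf sf.
  rewrite -abszE lez_nat -pmulrn => h; rewrite truncn_ge_nat //.
  by rewrite mulr_ge0 ?exprn_ge0 //; lra.
have signs f : Fset m D Q f -> f.[1] < 0 /\ 0 < f.[-1].
  case=> rf _ _ sf; have [] := salem_bounds _ _ _ _ m0 rf sf.
  by rewrite oppr_gt0 ltrz0 ltr0z => -[-> _] [-> _].
have -> : ((2 * M).+1 ^ (m - 2) = size (enum {ffun 'I_(m - 2) -> 'I_(2 * M).+1}))%N.
  by rewrite -cardE card_ffun !card_ord.
rewrite -(size_allpairs pair).
apply: (@finite_card_inj _ _ _ psi).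
- move=> f g Ff Fg [E1 EN1 /ffunP Ek].
  have [f1 fN1] := signs _ Ff; have [g1 gN1] := signs _ Fg.
  case: (Ff) => rf _ _ _; case: (Fg) => rg _ _ _.
  apply: (reciprocal_eq m) => //; [lia | lia |] => k /andP[k2 km].
  have ltk : (k - 2 < m - 2)%N by lia.
  have := congr1 val (Ek (Ordinal ltk)); rewrite !ffunE /= subnK //.
  have := coef_M f k Ff; have := coef_M g k Fg.
  move: ((trace_poly m f)`_k : int) ((trace_poly m g)`_k : int) => x y.
  by move=> hy hx; rewrite !inordK; lia.
- move=> f Ff; apply/allpairsP; exists ((psi f).1, (psi f).2); split => //=.
    have [f1 fN1] := signs _ Ff.
    case: (Ff) => rf _ [k kE] sf.
    have [b1 bN1 _] := salem_bounds _ _ _ _ m0 rf sf.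
    have X0 : 0 <= 4 ^+ (m - 1) * (Q + 3) by rewrite mulr_ge0 ?exprn_ge0 //; lra.
    have absE (z : int) : (`|z|%N%:R : R) = `|z%:~R|.
      by rewrite natr_absz intr_norm.
    have [n nE] : exists n : nat, (`|f.[1]| * `|f.[-1]| = D * n ^ 2)%N.
      apply: (sqf_mul_sqr_rat _ _ k) => //.
      have -> : (`|f.[1]| * `|f.[-1]|)%N%:R = - (f.[1] * f.[-1])%:~R :> rat.
        by rewrite natrM !natr_absz (ltr0_norm f1) (gtr0_norm fN1) -intrM mulNr mulrNz.
      by rewrite kE opprK.
    apply: (mem_square_product_pairs _ _ _ _ n) => //.
    + apply/andP; split; first by lia.
      by rewrite truncn_ge_nat // absE ltr0_norm ?ltrz0 //; case: b1.
    + apply/andP; split; first by lia.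
      by rewrite truncn_ge_nat // absE gtr0_norm ?ltr0z //; case: bN1.
  by rewrite mem_enum.
Qed.

(** * Numerical comparison with [kappa0] *)

Lemma leq_expn2r (a b e : nat) : (a <= b)%N -> (a ^ e <= b ^ e)%N.
Proof. by case: e => // e; rewrite leq_exp2r. Qed.

(** The factor 1 of the factorial saves a power of [h], a saving that [kappa0_odd_nat] exploits. *)
Lemma fact_leq_expn (h : nat) : (h`! <= h ^ h.-1)%N.
Proof.
elim: h => [|[|h] IH] //=.
rewrite factS expnS leq_mul //; apply: leq_trans IH _; rewrite /=.
by rewrite leq_expn2r.
Qed.

Lemma sqr_leq_exp3 (h : nat) : (h ^ 2 <= 3 ^ h)%N.
Proof.
elim: h => [|[|[|h]] IH] //.
rewrite [(3 ^ _)%N]expnS; apply: leq_trans (leq_mul (leqnn 3) IH); nia.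
Qed.

(** The case [m = 2h + 2]. After [h! <= h^h] both sides are [h]-th powers, and the bases compare
    because [h^2 <= 3^h] and [81 * 3 = 243 < 256 = 16 * 16]. *)
Lemma kappa0_even_nat (h : nat) :
  ((2 * 3 ^ (2 * h + 1)) ^ (2 * h) * h`! ^ 2 <=
   2 ^ ((2 * h + 1) * (2 * h)) * (2 ^ (2 * (2 * h + 2)) - 4) ^ h)%N.
Proof.
have base : (36 * 81 ^ h * h ^ 2 <= 4 * 16 ^ h * (16 * 16 ^ h - 4))%N.
  have h3 := sqr_leq_exp3 h.
  have e1 : (81 ^ h * 3 ^ h <= 16 ^ h * 16 ^ h)%N by rewrite -!expnMn leq_expn2r.
  have e2 : (0 < 16 ^ h)%N by rewrite expn_gt0.
  nia.
have -> : ((2 * 3 ^ (2 * h + 1)) ^ (2 * h) = (36 * 81 ^ h) ^ h)%N.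
  rewrite expnM; congr (_ ^ _)%N.
  rewrite expnMn -expnM (_ : (2 * h + 1) * 2 = 4 * h + 2)%N; last by lia.
  by rewrite expnD expnM mulnCA mulnC.
have -> : (2 ^ ((2 * h + 1) * (2 * h)) = (4 * 16 ^ h) ^ h)%N.
  rewrite mulnA expnM; congr (_ ^ _)%N.
  by rewrite (_ : 16 = 2 ^ 4)%N // -expnM (_ : 4 = 2 ^ 2)%N // -expnD; congr (_ ^ _)%N; lia.
have -> : (2 ^ (2 * (2 * h + 2)) = 16 * 16 ^ h)%N.
  by rewrite -expnS (_ : 16 = 2 ^ 4)%N // -expnM; congr (_ ^ _)%N; lia.
rewrite -expnMn; apply: (@leq_trans ((36 * 81 ^ h) ^ h * (h ^ 2) ^ h)).
  rewrite leq_mul // -expnM mulnC expnM leq_expn2r //.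
  apply: leq_trans (fact_leq_expn h) _.
  by case: (h) => // g; rewrite leq_pexp2l // leq_pred.
by rewrite -expnMn leq_expn2r.
Qed.

(** The case [m = 2h + 1] with [h = g + 1]. Once [2 * 9^h <= 2 * 16^h] is split off and [h! <= h^g]
    is used, [g]-th powers remain; their bases compare by [81^h h^2 + 16^h <= 256^h]. *)
Lemma kappa0_odd_nat (g : nat) :
  ((2 * 3 ^ (2 * g.+1)) ^ (2 * g + 1) * g.+1`! ^ 2 <=
   2 ^ ((4 * g.+1 + 1) * g.+1) * (2 ^ (4 * g.+1 + 1) - 2) ^ g)%N.
Proof.
set h := g.+1.
have base : (81 ^ h * h ^ 2 + 16 ^ h <= 256 ^ h)%N.
  (* The route through [h^2 <= 3^h] fails at [h = 1], since [243 + 16 > 256]; that case is computed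
     directly. *)
  rewrite /h; case: (g) => [|k] //.
  apply: (@leq_trans (243 ^ k.+2 + 16 ^ k.+2)).
    by rewrite leq_add2r (_ : 243 = 81 * 3)%N // expnMn leq_mul // sqr_leq_exp3.
  elim: k => // k; rewrite [(243 ^ k.+3)%N]expnS [(16 ^ k.+3)%N]expnS [(256 ^ k.+3)%N]expnS.
  by lia.
have e16 : (2 ^ (4 * h + 1) = 2 * 16 ^ h)%N.
  by rewrite addn1 expnS expnM.
have -> : (2 ^ ((4 * h + 1) * h) = 2 * 16 ^ h * (2 * 16 ^ h) ^ g)%N.
  by rewrite expnM e16 -expnS.
rewrite e16 -mulnA -expnMn.
have -> : ((2 * 3 ^ (2 * h)) ^ (2 * g + 1) = 2 * 9 ^ h * (4 * 81 ^ h) ^ g)%N.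
  have sq : ((2 * 9 ^ h) ^ 2 = 4 * 81 ^ h)%N.
    by rewrite expnMn -expnM [(h * 2)%N]mulnC expnM.
  by rewrite (expnM 3 2 h) addn1 expnS (expnM _ 2 g) sq.
rewrite -mulnA; apply: leq_mul; first by rewrite leq_mul // leq_expn2r.
apply: (@leq_trans ((4 * 81 ^ h) ^ g * (h ^ 2) ^ g)).
  by rewrite leq_mul // -expnM mulnC expnM leq_expn2r // (fact_leq_expn h).
rewrite -expnMn leq_expn2r //.
have e256 : (256 ^ h = 16 ^ h * 16 ^ h)%N by rewrite -expnMn.
rewrite e256 in base; nia.
Qed.

(** The left side is the leading coefficient in [Q] of the bound on the choices of the coefficients
    of degrees [2] to [m - 1]. *)
Lemma kappa0_ge (R : realType) (m : nat) : (1 < m)%N ->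
  (2 * 3 ^+ (m - 1)) ^+ (m - 2) <= kappa0 R m.
Proof.
move=> m1; rewrite /kappa0; case: ifP => om.
  have [g ->] : exists g, m = (2 * g.+1 + 1)%N.
    by exists (m - 3)./2; lia.
  have -> : (2 * g.+1 + 1 - 1 = 2 * g.+1)%N by lia.
  have -> : (2 * g.+1 + 1 - 2 = 2 * g + 1)%N by lia.
  have -> : (2 * (2 * g.+1 + 1) - 1 = 4 * g.+1 + 1)%N by lia.
  have -> : ((2 * g.+1 + 1 - 3)./2 = g)%N by lia.
  have -> : ((2 * g.+1)./2 = g.+1)%N by lia.
  rewrite ler_pdivlMr ?exprn_gt0 ?ltr0n ?fact_gt0 //.
  have := kappa0_odd_nat g; rewrite -(ler_nat R).
  (* With [2 <= 2 ^ e] the truncated subtraction agrees with the one in [R]. *)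
  set e := (4 * _ + 1)%N; have e2 : (2 <= 2 ^ e)%N.
    by rewrite -[X in (X <= _)%N]expn1 leq_exp2l //; lia.
  by rewrite (natrM R (_ ^ _)%N (g.+1`! ^ 2)%N) (natrM R (2 ^ _)%N) !natrX natrB // natrM !natrX.
have [h ->] : exists h, m = (2 * h + 2)%N by exists (m./2 - 1)%N; lia.
have -> : (2 * h + 2 - 1 = 2 * h + 1)%N by lia.
have -> : (2 * h + 2 - 2 = 2 * h)%N by lia.
have -> : ((2 * h + 2)./2 - 1 = h)%N by lia.
rewrite ler_pdivlMr ?exprn_gt0 ?ltr0n ?fact_gt0 //.
have := kappa0_even_nat h; rewrite -(ler_nat R).
set e := (2 * (2 * h + 2))%N; have e2 : (4 <= 2 ^ e)%N.
  by rewrite (_ : 4 = 2 ^ 2)%N // leq_exp2l //; lia.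
by rewrite (natrM R (_ ^ _)%N (h`! ^ 2)%N) (natrM R (2 ^ _)%N) !natrX natrB // natrM !natrX.
Qed.

(** Isolates the factor 4 or 3 that has to absorb [pi] or [pi / 2]. *)
Lemma kappaE (R : realType) (m D : nat) : (0 < m)%N ->
  kappa R m D = (if odd D then 4 else 3)
    * (2 ^+ size (primes D) * 4 ^+ (m - 1)) * kappa0 R m.
Proof.
move=> m0; rewrite /kappa; set t := size _.
have e3 : 2 ^+ (t + 2 * m - 2) = 2 ^+ t * 4 ^+ (m - 1) :> R.
  have -> : (t + 2 * m - 2 = t + 2 * (m - 1))%N by lia.
  by rewrite exprD (exprM (2 : R)) -[2 ^+ 2]natrX.
have e4 : 2 ^+ (t + 2 * m) = 4 * (2 ^+ t * 4 ^+ (m - 1)) :> R.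
  have -> : (t + 2 * m = 2 + (t + 2 * m - 2))%N by lia.
  by rewrite exprD e3 -[2 ^+ 2]natrX.
by case: ifP => _; rewrite ?e4 ?e3.
Qed.

(** * Asymptotics in [Q] *)

Lemma affine_exp_le (R : realFieldType) (A B : R) (n : nat) : 0 <= A -> 0 <= B ->
  exists2 C : R, 0 <= C & forall Q : R, 1 <= Q ->
    (Q + 3) * (A * Q + B) ^+ n <= A ^+ n * Q ^+ n.+1 + C * Q ^+ n.
Proof.
move=> A0 B0; elim: n => [|n [C C0 IH]].
  by exists 3 => // Q Q1; rewrite !expr0 expr1; lra.
(* The first two terms are the coefficient of [Q^(n+1)] after multiplication by [A Q + B]; the third
   comes from [B C Q^n <= B C Q^(n+1)]. *)
exists (B * A ^+ n + A * C + B * C).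
  by rewrite !addr_ge0 // mulr_ge0 // exprn_ge0.
move=> Q Q1; rewrite exprS mulrCA.
have Q0 : 0 <= Q by lra.
apply: le_trans (ler_wpM2l _ (IH Q Q1)) _; first by rewrite addr_ge0 // mulr_ge0.
have : 0 <= B * C * Q ^+ n * (Q - 1).
  by rewrite !mulr_ge0 ?exprn_ge0 // subr_ge0.
rewrite !exprS; move: (Q ^+ n) (A ^+ n) => q a; lra.
Qed.

(** The error [C Q^n (K + c ln Q)] is brought to order [Q^(n+1)] by [1 <= Q] and [ln Q <= Q]. *)
Lemma affine_exp_ln_le (R : realType) (A B K c : R) (n : nat) :
    0 <= A -> 0 <= B -> 0 <= K -> 0 <= c ->
  exists C : R, forall Q : R, 1 < Q ->
    (Q + 3) * (K + c * ln Q) * (A * Q + B) ^+ n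
      <= c * A ^+ n * Q ^+ n.+1 * ln Q + C * Q ^+ n.+1.
Proof.
move=> A0 B0 K0 c0; have [C C0 HC] := @affine_exp_le R A B n A0 B0.
exists (K * A ^+ n + C * K + C * c) => Q Q1.
have l0 : 0 <= ln Q by rewrite ln_ge0 // ltW.
have lQ : ln Q <= Q.
  have : ln (1 + (Q - 1)) <= Q - 1 by apply: le_ln1Dx; lra.
  rewrite addrC subrK; lra.
have Q0 : 0 <= Q by lra.
rewrite mulrAC; apply: le_trans (ler_wpM2r _ (HC Q (ltW Q1))) _.
  by rewrite addr_ge0 // mulr_ge0.
have q0 : 0 <= Q ^+ n by rewrite exprn_ge0.
have h1 : 0 <= C * K * Q ^+ n * (Q - 1) by rewrite !mulr_ge0 // subr_ge0 ltW.
have h2 : 0 <= C * c * Q ^+ n * (Q - ln Q) by rewrite !mulr_ge0 // subr_ge0.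
move: h1 h2; rewrite !exprS; move: (Q ^+ n) (A ^+ n) (ln Q) => q a l; lra.
Qed.

Theorem theorem4p5 (R : realType) (m D : nat)
  (m_gt0 : (0 < m)%N) (m_neq1 : m <> 1%N)
  (D_gt0 : (0 < D)%N) (D_sqf : squarefree D) :
  exists C : R, forall Q : R, 1 < Q ->
    finite_set (Fset m D Q) /\
    (#|` fset_set (Fset m D Q)|%fset)%:R
      <= kappa R m D / (pi * Num.sqrt D%:R) * Q ^+ (m - 1) * ln Q
         + C * Q ^+ (m - 1).
Proof.
have m1 : (1 < m)%N by lia.
have m2S : (m - 2).+1 = (m - 1)%N by lia.
pose c : R := if odd D then 1 else 2^-1.
have c0 : 0 <= c by rewrite /c; case: ifP => _; lra.
pose t := size (primes D).
(* From [N <= 4^(m-1) (Q + 3) <= 4^m Q] follows [ln N <= L + ln Q]. *)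
pose L : R := ln (4 ^+ m).
have L0 : 0 <= L by rewrite ln_ge0 // exprn_ege1 //; lra.
(* Chosen so that [2 M + 1 <= 2 * 3^(m-1) (Q + 2) + 1 = A Q + B]. *)
pose A : R := 2 * 3 ^+ (m - 1).
pose B : R := 4 * 3 ^+ (m - 1) + 1.
have p3 : 0 < 3 ^+ (m - 1) :> R by rewrite exprn_gt0.
have p4 : 0 < 4 ^+ (m - 1) :> R by rewrite exprn_gt0.
have A0 : 0 <= A by rewrite /A; lra.
have B0 : 0 <= B by rewrite /B; lra.
have K0 : 0 <= 1 + c * L by rewrite addr_ge0 // mulr_ge0.
have sD0 : 0 < Num.sqrt (D%:R : R) by rewrite sqrtr_gt0 ltr0n.
pose P : R := 2 ^+ t * 4 ^+ (m - 1) / Num.sqrt D%:R.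
have P0 : 0 <= P by rewrite /P divr_ge0 ?mulr_ge0 ?exprn_ge0 // ltW.
(* Besides [kappa0_ge] this needs [c pi <= 4] for odd [D], where [c = 1], and [c pi <= 3] for even
   [D], where [c = 1/2]; both follow from [pi <= 4]. *)
have lead : P * (c * A ^+ (m - 2)) <= kappa R m D / (pi * Num.sqrt D%:R).
  have pi0 := pi_gt0 R.
  have pi4 : pi <= 4 :> R by have := pihalf_lt2 R; lra.
  rewrite ler_pdivlMr ?mulr_gt0 //.
  have -> : P * (c * A ^+ (m - 2)) * (pi * Num.sqrt D%:R) =
            (c * pi) * (2 ^+ t * 4 ^+ (m - 1)) * A ^+ (m - 2).
    by rewrite /P; field; rewrite gt_eqF.
  rewrite kappaE // -/t.
  apply: ler_pM.
  - by rewrite !mulr_ge0 ?exprn_ge0 // ltW.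
  - by rewrite exprn_ge0.
  - rewrite ler_wpM2r ?mulr_ge0 ?exprn_ge0 //.
    by rewrite /c; case: ifP => _; lra.
  - exact: kappa0_ge.
have [C HC] := @affine_exp_ln_le R A B (1 + c * L) c (m - 2) A0 B0 K0 c0.
exists (P * C) => Q Q1.
have [fin card] := Fset_card_le R m D Q m1 D_gt0 D_sqf Q1.
split => //.
set N := Num.truncn _ in card; set M := Num.truncn _ in card.
have l0 : 0 <= ln Q by rewrite ln_ge0 // ltW.
have X1 : 1 <= 4 ^+ (m - 1) * (Q + 3).
  rewrite -[X in X <= _]mulr1 ler_pM // ?exprn_ege1 //; lra.
have NX : N%:R <= 4 ^+ (m - 1) * (Q + 3) by rewrite -truncn_ge_nat //; lra.
have N0 : (0 < N)%N by rewrite truncn_gt0.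
have lnN : ln N%:R <= L + ln Q.
  rewrite -lnM ?posrE ?exprn_gt0 //; last by lra.
  rewrite ler_ln ?posrE ?ltr0n ?mulr_gt0 ?exprn_gt0 //; last by lra.
  apply: le_trans NX _; rewrite -[X in 4 ^+ X * Q](subnK m_gt0) exprD expr1 -mulrA.
  by rewrite ler_wpM2l ?exprn_ge0 //; lra.
have MY : (2 * M).+1%:R <= A * Q + B.
  have : M%:R <= 3 ^+ (m - 1) * (Q + 2).
    by rewrite -truncn_ge_nat // mulr_ge0 ?exprn_ge0 //; lra.
  rewrite -[(2 * M).+1%:R]natr1 natrM /A /B; lra.
have pairs : (size (square_product_pairs D N))%:R <=
    P * ((Q + 3) * (1 + c * L + c * ln Q)).
  apply: le_trans (@size_square_product_pairs R D N D_gt0 D_sqf) _.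
  have -> : P * ((Q + 3) * (1 + c * L + c * ln Q)) =
    2 ^+ t * (4 ^+ (m - 1) * (Q + 3) / Num.sqrt D%:R) * (1 + c * (L + ln Q)).
    by rewrite /P; field; rewrite gt_eqF.
  apply: ler_pM.
  - by rewrite mulr_ge0 ?exprn_ge0 // divr_ge0 // ltW.
  - by rewrite addr_ge0 // mulr_ge0 // ln_ge0 // ler1n.
  - by rewrite ler_wpM2l ?exprn_ge0 // ler_wpM2r // invr_ge0 ltW.
  - by rewrite lerD2l ler_wpM2l.
apply: (@le_trans _ _ (P * ((Q + 3) * (1 + c * L + c * ln Q) * (A * Q + B) ^+ (m - 2)))).
  move: card; rewrite -(ler_nat R) => /le_trans; apply.
  rewrite natrM natrX mulrA; apply: ler_pM => //.
  by rewrite lerXn2r // nnegrE ?ler0n // addr_ge0 // mulr_ge0 //; lra.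
apply: le_trans (ler_wpM2l P0 (HC Q Q1)) _.
rewrite m2S.
rewrite mulrDr !mulrA lerD2r ler_wpM2r // ler_wpM2r ?exprn_ge0 //; first by lra.
by rewrite -mulrA.
Qed.
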